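(* Let $n\ge 2$ and let $\mathcal{P}_E^c(SD_{8n})$ be the conjugacy super enhanced power graph of the semidihedral group $SD_{8n}$. Put $\alpha=8n-1$, $\beta=6n-1$, $\gamma=4n-1$, $\delta=2n+1$. (i) If $n$ is odd, let $\psi=n$ and let $Q$ be the symmetric-pattern $6\times 6$ matrix \[\begin{bmatrix}0&\sqrt{\alpha^2+\beta^2}&(4n-2)\sqrt{\alpha^2+\gamma^2}&2n\sqrt{\alpha^2+\delta^2}&n\sqrt{\alpha^2+\psi^2}&n\sqrt{\alpha^2+\psi^2}\\ \sqrt{\alpha^2+\beta^2}&0&(4n-2)\sqrt{\beta^2+\gamma^2}&2n\sqrt{\beta^2+\delta^2}&0&0\\ \sqrt{\alpha^2+\gamma^2}&\sqrt{\beta^2+\gamma^2}&(4n-1)(4n-3)\sqrt2&0&0&0\\ \sqrt{\alpha^2+\delta^2}&\sqrt{\beta^2+\delta^2}&0&(2n-1)(2n+1)\sqrt2&0&0\\ \sqrt{\alpha^2+\psi^2}&0&0&0&n(n-1)\sqrt2&0\\ \sqrt{\alpha^2+\psi^2}&0&0&0&0&n(n-1)\sqrt2\end{bmatrix}.\] Then the Sombor spectrum of $\mathcal{P}_E^c(SD_{8n})$ consists of $-(2n+1)\sqrt2$ with multiplicity $2n-1$, $-(4n-1)\sqrt2$ with multiplicity $4n-3$, $-n\sqrt2$ with multiplicity $2n-2$, together with the eigenvalues (with multiplicity) of $Q$. (ii) If $n$ is even, let $\psi=2n$ and let $Q'$ be the $5\times5$ matrix \[\begin{bmatrix}0&\sqrt{\alpha^2+\beta^2}&(4n-2)\sqrt{\alpha^2+\gamma^2}&2n\sqrt{\alpha^2+\delta^2}&2n\sqrt{\alpha^2+\psi^2}\\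 \sqrt{\alpha^2+\beta^2}&0&(4n-2)\sqrt{\beta^2+\gamma^2}&2n\sqrt{\beta^2+\delta^2}&0\\ \sqrt{\alpha^2+\gamma^2}&\sqrt{\beta^2+\gamma^2}&(4n-1)(4n-3)\sqrt2&0&0\\ \sqrt{\alpha^2+\delta^2}&\sqrt{\beta^2+\delta^2}&0&(2n-1)(2n+1)\sqrt2&0\\ \sqrt{\alpha^2+\psi^2}&0&0&0&2n(2n-1)\sqrt2\end{bmatrix}.\] Then the Sombor spectrum of $\mathcal{P}_E^c(SD_{8n})$ consists of $-(4n-1)\sqrt2$ with multiplicity $4n-3$, $-(2n+1)\sqrt2$ with multiplicity $2n-1$, $-2n\sqrt2$ with multiplicity $2n-1$, together with the eigenvalues (with multiplicity) of $Q'$.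
   Context: For a finite simple graph $\Gamma$ with vertices $u_1,\dots,u_N$, the Sombor matrix $S(\Gamma)$ has $(i,j)$ entry $\sqrt{\deg(u_i)^2+\deg(u_j)^2}$ if $u_i,u_j$ are adjacent and $0$ otherwise; the Sombor spectrum is the multiset of its eigenvalues. $SD_{8n}=\langle a,b: a^{4n}=b^2=e,\ ba=a^{2n-1}b\rangle$ of order $8n$. The enhanced power graph $\mathcal{P}_E(G)$ has vertex set $G$, distinct vertices adjacent iff they lie in a common cyclic subgroup. The conjugacy super enhanced power graph $\mathcal{P}_E^c(G)$ has vertex set $G$, and distinct $g,h$ are adjacent iff $g,h$ are conjugate or there exist $g'$ conjugate to $g$ and $h'$ conjugate to $h$ adjacent in $\mathcal{P}_E(G)$. *)

(* Defs.v *)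
From HB Require Import structures.
From mathcomp Require Import all_boot all_order all_algebra all_fingroup.
Set Implicit Arguments. Unset Strict Implicit. Unset Printing Implicit Defensive.
Import Order.TTheory GRing.Theory Num.Theory.

Definition epg_adj (gT : finGroupType) (G : {set gT}) (x y : gT) : bool :=
  (x != y) && [exists z in G, (x \in <[z]>%g) && (y \in <[z]>%g)].

Definition cse_adj (gT : finGroupType) (G : {set gT}) (x y : gT) : bool :=
  (x != y) &&
  ((x \in (y ^: G)%g) ||
   [exists x' in (x ^: G)%g, exists y' in (y ^: G)%g, epg_adj G x' y']).

Definition gdeg (gT : finGroupType) (G : {set gT}) (adj : rel gT) (x : gT) : nat :=
  #|[set y in G | adj x y]|.

Definition sombor_mx (R : rcfType) (gT : finGroupType) (G : {set gT})
    (adj : rel gT) : 'M[R]_#|G| :=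
  \matrix_(i < #|G|, j < #|G|)
    (let x := @enum_val _ (mem G) i in let y := @enum_val _ (mem G) j in
     if adj x y
     then Num.sqrt ((gdeg G adj x)%:R ^+ 2 + (gdeg G adj y)%:R ^+ 2)
     else 0)%R.

Local Open Scope ring_scope.

Definition sb (R : rcfType) (x y : nat) : R := Num.sqrt (x%:R ^+ 2 + y%:R ^+ 2).

Definition mx_of_rows (R : rcfType) (m : nat) (rows : seq (seq R)) : 'M[R]_m :=
  \matrix_(i < m, j < m) nth 0 (nth [::] rows i) j.

Definition Q_odd (R : rcfType) (n : nat) : 'M[R]_6 :=
  let al := (8*n-1)%N in let be := (6*n-1)%N in let ga := (4*n-1)%N in
  let de := (2*n+1)%N in let ps := n in
  mx_of_rows 6
  [:: [:: 0; sb R al be; (4*n-2)%:R * sb R al ga; (2*n)%:R * sb R al de;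
          n%:R * sb R al ps; n%:R * sb R al ps];
      [:: sb R al be; 0; (4*n-2)%:R * sb R be ga; (2*n)%:R * sb R be de; 0; 0];
      [:: sb R al ga; sb R be ga; ((4*n-1)*(4*n-3))%:R * Num.sqrt 2; 0; 0; 0];
      [:: sb R al de; sb R be de; 0; ((2*n-1)*(2*n+1))%:R * Num.sqrt 2; 0; 0];
      [:: sb R al ps; 0; 0; 0; (n*(n-1))%:R * Num.sqrt 2; 0];
      [:: sb R al ps; 0; 0; 0; 0; (n*(n-1))%:R * Num.sqrt 2]].

Definition Q_even (R : rcfType) (n : nat) : 'M[R]_5 :=
  let al := (8*n-1)%N in let be := (6*n-1)%N in let ga := (4*n-1)%N in
  let de := (2*n+1)%N in let ps := (2*n)%N in
  mx_of_rows 5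
  [:: [:: 0; sb R al be; (4*n-2)%:R * sb R al ga; (2*n)%:R * sb R al de;
          (2*n)%:R * sb R al ps];
      [:: sb R al be; 0; (4*n-2)%:R * sb R be ga; (2*n)%:R * sb R be de; 0];
      [:: sb R al ga; sb R be ga; ((4*n-1)*(4*n-3))%:R * Num.sqrt 2; 0; 0];
      [:: sb R al de; sb R be de; 0; ((2*n-1)*(2*n+1))%:R * Num.sqrt 2; 0];
      [:: sb R al ps; 0; 0; 0; ((2*n)*(2*n-1))%:R * Num.sqrt 2]].

(* Main.v *)
(* The graph is a blow-up: SD_{8n} splits into cells such that adjacency of two
   distinct vertices depends only on their cells, each cell being a clique.  Hence
   X - S = D' - P W P^T with P the incidence matrix of the cells, D' diagonal and
   constant on the cells, and Sylvester's determinant identity extracts the diagonal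
   eigenvalues and leaves the quotient matrix.  The cells come from two facts on
   x outside <a>: its conjugacy class is the coset <a^(2n-2)> x, and its square is
   1 or a^(2n) according to the parity of i in x = a^i b. *)
Require Import Defs.
From HB Require Import structures.
From mathcomp Require Import all_boot all_order all_algebra all_fingroup.
From mathcomp Require Import cyclic zify ring.
Set Implicit Arguments. Unset Strict Implicit. Unset Printing Implicit Defensive.
Import Order.TTheory GRing.Theory Num.Theory.
Local Open Scope ring_scope.

(** * Determinants of matrices that are constant on cells up to a diagonal term *)

(* Sylvester's identity for a low-rank update, cleared of denominators so that it
   holds over the polynomial ring. *)
Lemma mul_det_cells (R : comNzRingType) (N m : nat) (e : 'I_m -> R)
    (W : 'M[R]_m) (c : 'I_N -> 'I_m) :
  \det (\matrix_(i, j) (e (c i) *+ (i == j) - W (c i) (c j))) * \prod_k e k =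
  \prod_i e (c i) *
  \det (\matrix_(k, l) (e k *+ (k == l) - W k l *+ #|[set i | c i == l]|)).
Proof.
pose P : 'M[R]_(N, m) := \matrix_(i, k) (c i == k)%:R.
pose D' : 'M[R]_N := diag_mx (\row_i e (c i)).
pose D : 'M[R]_m := diag_mx (\row_k e k).
have mulP (p : nat) (B : 'M[R]_(m, p)) i j : (P *m B) i j = B (c i) j.
  rewrite mxE (bigD1 (c i)) //= mxE eqxx mul1r big1 ?addr0 // => k ck.
  by rewrite mxE eq_sym (negPf ck) mul0r.
have mulPT (p : nat) (B : 'M[R]_(p, m)) i j : (B *m P^T) i j = B i (c j).
  by rewrite -[B]trmxK -trmx_mul mxE mulP !mxE.
(* This is where [D'] being constant on cells enters; it replaces any inversion of [D'] or [D]. *)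
have DP : D' *m P = P *m D.
  apply/matrixP=> i k; rewrite mulP mul_diag_mx !mxE.
  by case: eqP => [->|_]; rewrite ?mulr1 ?mulr0.
have PP : P^T *m P = diag_mx (\row_k #|[set i | c i == k]|%:R).
  apply/matrixP=> k l; rewrite !mxE -sum1_card natr_sum.
  case: eqP => [<-|kl].
    rewrite mulr1n [RHS](big_mkcond (fun i => i \in _)).
    apply: eq_bigr => i _; rewrite !mxE inE.
    by case: eqP; rewrite ?mulr1 ?mulr0.
  rewrite mulr0n big1 // => i _; rewrite !mxE.
  by case: (c i =P k) kl => [->|_] ?; rewrite ?mul0r // (introF eqP) ?mulr0.
have -> : \matrix_(i, j) (e (c i) *+ (i == j) - W (c i) (c j)) =
    D' - P *m (W *m P^T).
  apply/matrixP=> i j; rewrite [RHS]mxE [X in _ = _ + X]mxE mulP mulPT !mxE.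
  by case: eqP => [->|].
have -> : \matrix_(k, l) (e k *+ (k == l) - W k l *+ #|[set i | c i == l]|) =
    D - W *m P^T *m P.
  rewrite -mulmxA PP; apply/matrixP=> k l.
  by rewrite mul_mx_diag !mxE mulr_natr.
have detD' : \det D' = \prod_i e (c i).
  by rewrite det_diag; apply: eq_bigr => i _; rewrite mxE.
have detD : \det D = \prod_i e i.
  by rewrite det_diag; apply: eq_bigr => i _; rewrite mxE.
rewrite -detD' -detD.
(* The first determinant is a Schur complement of this block matrix. Multiplying the block matrix on
   the right by the one for [\det D] below clears its upper right corner by [DP] and leaves the
   other complement. *)
have <- : \det (block_mx D' P (W *m P^T) 1%:M) = \det (D' - P *m (W *m P^T)).
  transitivity (\det (block_mx (D' - P *m (W *m P^T)) P 0 1%:M *m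
                      block_mx 1%:M 0 (W *m P^T) 1%:M)); last first.
    by rewrite det_mulmx det_ublock det_lblock !det1 !mulr1.
  by rewrite mulmx_block !mulmx1 !mulmx0 !mul1mx subrK !add0r.
have -> : \det D = \det (block_mx 1%:M (- P) 0 D) by rewrite det_ublock det1 mul1r.
rewrite -det_mulmx mulmx_block.
rewrite !mulmx1 !mulmx0 !addr0 !mulmxN DP addNr mul1mx det_lblock.
by rewrite [- _ + D]addrC.
Qed.

(** Take [e k = X + d k] in the identity above. The product over all indices contains each [e k]
    once per element of its cell, and one copy of each, being monic, cancels; nonempty cells make
    the predecessor a true exponent. *)
Lemma char_poly_cells (R : idomainType) (N m : nat) (d : 'I_m -> R)
    (W : 'M[R]_m) (c : 'I_N -> 'I_m) :
  (forall k, (0 < #|[set i | c i == k]|)%N) ->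
  char_poly (\matrix_(i, j) (W (c i) (c j) - d (c i) *+ (i == j))) =
  \prod_k ('X + (d k)%:P) ^+ #|[set i | c i == k]|.-1 *
  char_poly (\matrix_(k, l) (W k l *+ #|[set i | c i == l]| - d k *+ (k == l))).
Proof.
move=> c_gt0; pose e k : {poly R} := 'X + (d k)%:P.
have e_neq0 : \prod_k e k != 0.
  by apply/prodf_neq0 => k _; rewrite -size_poly_eq0 /e size_XaddC.
apply: (mulIf e_neq0).
have {1}-> : char_poly (\matrix_(i, j) (W (c i) (c j) - d (c i) *+ (i == j))) =
   \det (\matrix_(i, j) (e (c i) *+ (i == j) - map_mx polyC W (c i) (c j))).
  congr (\det _); apply/matrixP=> i j; rewrite !mxE /e rmorphB rmorphMn /=.
  by rewrite mulrnDl opprB addrA.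
rewrite mul_det_cells.
have -> : \prod_i e (c i) = \prod_k e k ^+ #|[set i | c i == k]|.-1 * \prod_k e k.
  rewrite -big_split /= (partition_big c predT) //=; apply: eq_bigr => k _.
  rewrite -exprSr prednK // -prodr_const; apply: eq_big => [i|i /eqP-> //].
  by rewrite inE.
rewrite mulrAC; congr (_ * _ * _).
congr (\det _); apply/matrixP=> i j; rewrite !mxE /e rmorphB !rmorphMn /=.
by rewrite mulrnDl opprB addrA.
Qed.

(** * Sombor matrices of graphs that are blow-ups on cells *)

Lemma sb_diag (R : rcfType) (x : nat) : sb R x x = x%:R * Num.sqrt 2.
Proof. by rewrite /sb -mulr2n -[_ *+ 2]mulr_natr sqrtrM ?sqr_ge0 // sqrtr_sqr normr_nat. Qed.

(** Reflexivity of [E] makes the sum count [x] itself; the predecessor removes it. *)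
Lemma gdeg_cells (gT : finGroupType) (G : {set gT}) (adj : rel gT) (m : nat)
    (E : rel 'I_m) (c : gT -> 'I_m) (x : gT) :
  reflexive E ->
  {in G &, forall x y, adj x y = (x != y) && E (c x) (c y)} -> x \in G ->
  gdeg G adj x = (\sum_(l | E (c x) l) #|[set y in G | c y == l]|).-1.
Proof.
move=> Er adjE xG; pose S := [set y in G | E (c x) (c y)].
have -> : gdeg G adj x = #|S|.-1.
  rewrite (cardsD1 x S) inE xG Er /=; congr #|pred_of_set _|.
  apply/setP=> y; rewrite !inE; case yG: (y \in G); rewrite ?andbF //=.
  by rewrite adjE // eq_sym.
congr _.-1; rewrite -sum1_card (partition_big c (E (c x))) /=; last first.
  by move=> y; rewrite inE => /andP[].
apply: eq_bigr => l El; rewrite -sum1_card; apply: eq_bigl => y.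
by rewrite !inE -andbA; case: (y \in G) => //=; case: eqP => [->|]; rewrite ?El ?andbF.
Qed.

Lemma char_poly_sombor_cells (R : rcfType) (gT : finGroupType) (G : {set gT})
    (adj : rel gT) (m : nat) (E : rel 'I_m) (c : gT -> 'I_m) (s d : 'I_m -> nat) :
  reflexive E ->
  {in G &, forall x y, adj x y = (x != y) && E (c x) (c y)} ->
  (forall k, #|[set x in G | c x == k]| = s k) -> (forall k, 0 < s k)%N ->
  (forall k, d k = (\sum_(l | E k l) s l).-1) ->
  char_poly (sombor_mx R G adj) =
  \prod_k ('X + ((d k)%:R * Num.sqrt 2)%:P) ^+ (s k).-1 *
  char_poly (\matrix_(k, l) if E k l then (s l - (k == l))%:R * sb R (d k) (d l)
                            else 0).
Proof.
move=> Er adjE cs s_gt0 ds.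
pose f i := c (@enum_val _ (mem G) i).
have fs k : #|[set i | f i == k]| = s k.
  rewrite -cs -(card_imset _ enum_val_inj); congr #|pred_of_set _|.
  apply/setP=> x; rewrite !inE; apply/imsetP/andP => [[i]|[xG /eqP cx]].
    by rewrite inE => fi ->; split=> //; apply: enum_valP.
  by exists (enum_rank_in xG x); rewrite ?inE /f ?enum_rankK_in ?cx.
have degE x : x \in G -> gdeg G adj x = d (c x).
  move=> xG; rewrite (gdeg_cells (E := E) (c := c)) // ds; congr _.-1.
  by apply: eq_bigr => l _; rewrite cs.
pose W : 'M[R]_m := \matrix_(k, l) if E k l then sb R (d k) (d l) else 0.
(* [W] treats a vertex as adjacent to itself; the subtracted diagonal term [sb R d d], that is [d]
   times the root of 2, corrects this. In the quotient the same correction becomes the factor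
   [s l - (k == l)]. *)
have -> : sombor_mx R G adj =
    \matrix_(i, j) (W (f i) (f j) - ((d (f i))%:R * Num.sqrt 2) *+ (i == j)).
  apply/matrixP=> i j; rewrite !mxE /= adjE ?enum_valP // !degE ?enum_valP //.
  rewrite (inj_eq enum_val_inj); case: eqP => [->|_] /=; last by rewrite mulr0n subr0.
  by rewrite Er sb_diag subrr.
rewrite (char_poly_cells (fun k => (d k)%:R * Num.sqrt 2) W (c := f)); last first.
  by move=> k; rewrite fs.
congr (_ * _); first by apply: eq_bigr => k _; rewrite fs.
congr char_poly; apply/matrixP=> k l; rewrite !mxE fs.
case: eqP => [<-|_]; first by rewrite Er -sb_diag -mulrnBr ?mulr_natl.
by case: ifP; rewrite subr0 ?mul0rn ?mulr_natl // subn0.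
Qed.

(** * Normal form and exponent arithmetic in the semidihedral group *)

Local Open Scope group_scope.


Record sd_gens (n : nat) (gT : finGroupType) (G : {group gT}) (a b : gT) : Prop :=
  SdGens {
    sd_order : #[a] = (4 * n)%N;
    sd_sqb : b ^+ 2 = 1;
    sd_mulba : b * a = a ^+ (2 * n - 1) * b;
    sd_bNA : b \notin <[a]>;
    sd_cover : <[a]> :|: <[a]> :* b = G }.

(** The relations bound the orders of [a] and [b] by [4 * n] and 2 and make [<[b]>] normalise
    [<[a]>], so G is the product of the two. The order [8 * n] then forces both bounds to be
    attained and the intersection to be trivial. *)
Lemma sd_gens_exist (n : nat) (gT : finGroupType) (G : {group gT}) :
  (0 < n)%N ->
  G \homg Grp (a : b : (a ^+ (4 * n), b ^+ 2, b * a = a ^+ (2 * n - 1) * b)) ->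
  #|G| = (8 * n)%N -> exists a b, sd_gens n G a b.
Proof.
move=> n_gt0 /existsP[[a b] /= /eqP[defG a4n b2 ba]] cardG; exists a, b.
have bb : b * b = 1 by rewrite -expg2.
have nab : <[b]> \subset 'N(<[a]>).
  rewrite cycle_subG inE -cycleJ cycle_subG conjgE.
  have -> : b^-1 = b by apply/eqP; rewrite eq_invg_mul bb.
  by rewrite mulgA ba -mulgA bb mulg1 mem_cycle.
rewrite (norm_joinEr nab) in defG.
have oa : (#[a] <= 4 * n)%N.
  by apply: dvdn_leq; rewrite ?muln_gt0 ?n_gt0 // order_dvdn a4n.
have ob : (#[b] <= 2)%N by apply: dvdn_leq; rewrite ?order_dvdn ?b2.
have := mul_cardG <[a]> <[b]>; rewrite defG cardG -!orderE => cardM.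
have I_gt0 : (0 < #|<[a]> :&: <[b]>|)%N by rewrite cardG_gt0.
have [oa' [ob' cI]] : (#[a] = 4 * n /\ #[b] = 2 /\ #|<[a]> :&: <[b]>| = 1)%N.
  move: #[a] #[b] #|_| oa ob cardM I_gt0 => p q c p_le q_le pq c_gt0.
  have c1 : c = 1%N by have := leq_mul p_le q_le; rewrite pq; nia.
  by rewrite c1 muln1 in pq; have q2 : q = 2%N; nia.
split=> //.
  apply/negP => bA.
  have : b \in <[a]> :&: <[b]> by rewrite inE bA cycle_id.
  by rewrite (card1_trivg cI) inE => /eqP b1; move: ob'; rewrite b1 order1.
apply/eqP; rewrite eqEsubset -defG; apply/andP; split.
  by rewrite subUset mulg_subl ?group1 //= mulgS // sub1set cycle_id.
apply/subsetP=> _ /mulsgP[u _ uA /cyclePmin[i lti ->] ->].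
rewrite ob' in lti; case: i lti => [|[|//]] _; rewrite inE ?mulg1 ?uA //.
by rewrite mem_rcoset mulgK uA orbT.
Qed.

Lemma sd_mulbX (n : nat) (gT : finGroupType) (G : {group gT}) (a b : gT) (i : nat) :
  sd_gens n G a b -> b * a ^+ i = a ^+ ((2 * n - 1) * i) * b.
Proof.
case=> _ _ ba _ _; elim: i => [|i IHi]; first by rewrite muln0 mulg1 mul1g.
by rewrite expgSr mulgA IHi -mulgA ba mulgA -expgD mulnS addnC.
Qed.

Lemma sd_memP (n : nat) (gT : finGroupType) (G : {group gT}) (a b x : gT) :
  sd_gens n G a b -> x \in G ->
  (exists i, x = a ^+ i) \/ (exists i, x = a ^+ i * b).
Proof.
case=> _ _ _ _ <-; case/setUP => [/cycleP|/rcosetP[_ /cycleP[i ->] ->]].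
  by left.
by right; exists i.
Qed.

Lemma sd_memX (n : nat) (gT : finGroupType) (G : {group gT}) (a b : gT) (i : nat) :
  sd_gens n G a b -> a ^+ i \in G.
Proof. by case=> _ _ _ _ <-; rewrite inE mem_cycle. Qed.

Lemma sd_memXb (n : nat) (gT : finGroupType) (G : {group gT}) (a b : gT) (i : nat) :
  sd_gens n G a b -> a ^+ i * b \in G.
Proof. by case=> _ _ _ _ <-; rewrite inE mem_rcoset mulgK mem_cycle orbT. Qed.

Lemma sd_XbNA (n : nat) (gT : finGroupType) (G : {group gT}) (a b : gT) (i : nat) :
  sd_gens n G a b -> (a ^+ i * b \in <[a]>) = false.
Proof. by case=> _ _ _ /negPf bNA _; rewrite groupMl ?mem_cycle. Qed.

Lemma sd_expn_mod (n : nat) (gT : finGroupType) (G : {group gT}) (a b : gT) (i j : nat) :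
  sd_gens n G a b -> i = j %[mod 4 * n] -> a ^+ i = a ^+ j.
Proof. by case=> oa *; apply/eqP; rewrite eq_expg_mod_order oa; apply/eqP. Qed.

(** Exponents matter only modulo [#[a]], and [k %| #[a]] lets that congruence descend to one modulo
    [k]. *)
Lemma mem_cycleX (gT : finGroupType) (a : gT) (k i : nat) :
  (k %| #[a])%N -> (a ^+ i \in <[a ^+ k]>) = (k %| i)%N.
Proof.
move=> k_a; apply/idP/idP => [/cycleP[j]|/dvdnP[j ->]]; last first.
  by rewrite mulnC expgM mem_cycle.
rewrite -expgM => /eqP; rewrite eq_expg_mod_order => /eqP eq_ij.
rewrite /dvdn -(modn_dvdm _ k_a) eq_ij modn_dvdm //.
by rewrite modnMr.
Qed.

Lemma sd_mem_rcoset (n : nat) (gT : finGroupType) (G : {group gT}) (a b : gT)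
    (k i j : nat) :
  sd_gens n G a b -> (1 < n)%N -> (k %| 4 * n)%N ->
  (a ^+ i * b \in <[a ^+ k]> :* (a ^+ j * b)) = (i == j %[mod k]).
Proof.
move=> sd n_gt1 k_n; have oa := sd_order sd.
rewrite mem_rcoset invMg mulgA mulgK.
(* Exponents are natural numbers, so [(4 * n - 1) * j] stands for minus [j]. *)
have -> : (a ^+ j)^-1 = a ^+ ((4 * n - 1) * j).
  apply/eqP; rewrite eq_invg_mul -expgD; apply/eqP.
  have -> : (j + (4 * n - 1) * j = #[a] * j)%N by rewrite oa; nia.
  by rewrite expgM expg_order expg1n.
rewrite -expgD mem_cycleX ?oa //.
transitivity (i + (4 * n - 1) * j == 0 %[mod k])%N; first by rewrite mod0n.
rewrite -(eqn_modDr j) add0n -addnA.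
have -> : ((4 * n - 1) * j + j = 4 * n * j)%N by nia.
by rewrite -modnDmr (eqP (dvdn_mulr j k_n)) addn0.
Qed.

(** * Conjugacy classes outside [<[a]>] *)

Definition sd_step (n : nat) : nat := if odd n then 4 else 2.

Lemma sd_step_dvd (n : nat) : (sd_step n %| 4 * n)%N.
Proof. by rewrite /sd_step; case: ifP => _; rewrite dvdn_mulr. Qed.

(* [sd_step n] is the gcd of [2n - 2] and [4n]; the witnesses in the proof are
   solutions [t] of [(2n - 2) t = sd_step n] modulo [4n]. *)
Lemma sd_cycle_step (n : nat) (gT : finGroupType) (G : {group gT}) (a b : gT) :
  sd_gens n G a b -> (1 < n)%N -> <[a ^+ (2 * n - 2)]> = <[a ^+ sd_step n]>.
Proof.
move=> sd n_gt1; have oa := sd_order sd; apply/eqP; rewrite eqEsubset !cycle_subG.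
rewrite mem_cycleX ?oa ?sd_step_dvd //; apply/andP; split.
  by rewrite /sd_step; case: ifP => n_odd; apply/dvdnP;
     [exists n./2 | exists (n - 1)%N]; lia.
apply/cycleP; exists (if odd n then 4 * n - 2 else 3 * n - 1)%N.
rewrite -expgM; apply: (sd_expn_mod sd); rewrite /sd_step; case: ifP => n_odd.
  have -> : ((2 * n - 2) * (4 * n - 2) = (2 * n - 3) * (4 * n) + 4)%N by nia.
  by rewrite modnMDl.
have n2 : n = n./2.*2 by lia.
have -> : ((2 * n - 2) * (3 * n - 1) = (3 * n./2 - 2) * (4 * n) + 2)%N by nia.
by rewrite modnMDl.
Qed.

(** Conjugating by [a ^+ j] multiplies on the left by [a ^+ ((2 * n - 2) * j)], and conjugating by
    [a ^+ j * b] also by a power of [a ^+ (2 * n - 2)]. Hence there are [sd_step n] classes outside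
    [<[a]>]. *)
Lemma sd_class (n : nat) (gT : finGroupType) (G : {group gT}) (a b : gT) (i : nat) :
  sd_gens n G a b -> (1 < n)%N ->
  (a ^+ i * b) ^: G = <[a ^+ sd_step n]> :* (a ^+ i * b).
Proof.
move=> sd n_gt1; rewrite -(sd_cycle_step sd n_gt1).
have bb : b * b = 1 by rewrite -expg2 (sd_sqb sd).
have conjP (x g y : gT) : x * g = g * y -> x ^ g = y.
  by move=> xg; rewrite conjgE xg mulKg.
have mulXb u v : (a ^+ u * b) * a ^+ v = a ^+ (u + (2 * n - 1) * v) * b.
  by rewrite -mulgA (sd_mulbX _ sd) mulgA -expgD.
have conjX j : (a ^+ i * b) ^ (a ^+ j) = a ^+ ((2 * n - 2) * j) * (a ^+ i * b).
  apply: conjP; rewrite mulXb !mulgA -!expgD; congr (a ^+ _ * b); nia.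
apply/eqP; rewrite eqEsubset; apply/andP; split; apply/subsetP => y.
  case/imsetP=> g gG ->; have [[j ->]|[j ->]] := sd_memP sd gG.
    by rewrite conjX mem_rcoset mulgK expgM mem_cycle.
  (* Conjugation by [a ^+ j] changes the exponent [i] to [i + (2 * n - 2) * j], and conjugation by
     [b] then multiplies it by [2 * n - 1]. The check below rests on the square of [2 * n - 1] being
     1 modulo [4 * n]. *)
  have -> : (a ^+ i * b) ^ (a ^+ j * b) =
            a ^+ ((2 * n - 2) * (i + (2 * n - 1) * j)) * (a ^+ i * b).
    apply: conjP; rewrite mulgA mulXb -mulgA bb mulg1 [_ * (_ * b)]mulgA -expgD.
    rewrite -[a ^+ j * b * _]mulgA [b * _]mulgA (sd_mulbX _ sd) -[_ * b * b]mulgA bb mulg1.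
    rewrite -expgD; apply: (sd_expn_mod sd).
    have -> : (j + (2 * n - 1) * ((2 * n - 2) * (i + (2 * n - 1) * j) + i) =
       ((n - 1) * i + (2 * n - 2) * (n - 1) * j) * (4 * n) + (i + (2 * n - 1) * j))%N.
      case: (n) n_gt1 => // k _.
      have -> : (2 * k.+1 - 1 = k.*2.+1)%N by lia.
      have -> : (2 * k.+1 - 2 = k.*2)%N by lia.
      by rewrite subSS subn0 -mul2n; ring.
    by rewrite modnMDl.
  by rewrite mem_rcoset mulgK expgM mem_cycle.
case/rcosetP=> _ /cycleP[j ->] ->; rewrite -expgM -conjX.
by rewrite memJ_class ?(sd_memX _ sd).
Qed.

(** * The cells and their invariance under conjugation *)

(* Cells: the identity, the central involution, the other rotations, the elements
   of order 4 outside [<[a]>], and the conjugacy classes of [b] and of [a ^+ 2 * b].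
   The last two coincide when [n] is even, and then cell 5 is empty. *)
Definition sd_cell (n : nat) (gT : finGroupType) (a b x : gT) : nat :=
  if x == 1%g then 0%N
  else if x == a ^+ (2 * n) then 1%N
  else if x \in <[a]> then 2%N
  else if x \in <[a ^+ 2]> :* (a ^+ 1 * b) then 3%N
  else if x \in <[a ^+ sd_step n]> :* (a ^+ 0 * b) then 4%N
  else 5%N.

(* The maximal cyclic subgroup [<[a]>] meets cells 0, 1, 2; a conjugate of
   [<[a * b]>], of order 4, meets cells 0, 1, 3. *)
Definition sd_joined (k l : nat) : bool :=
  [|| k == l, k == 0, l == 0, (k <= 2) && (l <= 2) |
      (k \in [:: 1; 3]) && (l \in [:: 1; 3])]%N.

Lemma sd_cell_Xb (n : nat) (gT : finGroupType) (G : {group gT}) (a b : gT) (i : nat) :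
  sd_gens n G a b -> (1 < n)%N ->
  sd_cell n a b (a ^+ i * b) =
  (if odd i then 3 else if sd_step n %| i then 4 else 5)%N.
Proof.
move=> sd n_gt1; rewrite /sd_cell.
have XbN j : (a ^+ i * b == a ^+ j) = false.
  by apply/eqP => e; have := sd_XbNA i sd; rewrite e mem_cycle.
rewrite -(expg0 a) !XbN (sd_XbNA _ sd).
rewrite (sd_mem_rcoset _ _ sd) ?dvdn_mulr //.
by rewrite (sd_mem_rcoset _ _ sd) ?sd_step_dvd // !modn2 eqb1 mod0n.
Qed.

Lemma sd_cell_cycle (n : nat) (gT : finGroupType) (G : {group gT}) (a b x : gT) :
  sd_gens n G a b -> (1 < n)%N -> x \in G ->
  (sd_cell n a b x <= 2)%N = (x \in <[a]>).
Proof.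
move=> sd n_gt1 xG; have [[i ->]|[i ->]] := sd_memP sd xG.
  by rewrite mem_cycle /sd_cell mem_cycle; do 2?case: ifP => _.
by rewrite (sd_cell_Xb _ sd) // (sd_XbNA _ sd); do 2?case: ifP => _.
Qed.

Lemma sd_cell0 (n : nat) (gT : finGroupType) (a b x : gT) :
  (sd_cell n a b x == 0%N) = (x == 1).
Proof. by rewrite /sd_cell; case: (x =P 1) => // _; do 4?case: ifP => _. Qed.

Lemma sd_cell1 (n : nat) (gT : finGroupType) (G : {group gT}) (a b x : gT) :
  sd_gens n G a b -> (1 < n)%N -> (sd_cell n a b x == 1%N) = (x == a ^+ (2 * n)).
Proof.
move=> sd n_gt1; rewrite /sd_cell; case: (x =P a ^+ (2 * n)) => [->|_];
  last by do 4?case: ifP => _.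
case: (a ^+ (2 * n) =P 1) => // /eqP; rewrite -order_dvdn (sd_order sd) => a2n.
by have := dvdn_leq _ a2n; lia.
Qed.

Lemma sd_centralX (n : nat) (gT : finGroupType) (G : {group gT}) (a b g : gT) :
  sd_gens n G a b -> (1 < n)%N -> g \in G -> a ^+ (2 * n) ^ g = a ^+ (2 * n).
Proof.
move=> sd n_gt1 gG; apply/conjg_fixP/commgP.
have [[j ->]|[j ->]] := sd_memP sd gG; first exact/commuteX2.
apply: commuteM; first exact/commuteX2.
rewrite /commute (sd_mulbX _ sd); congr (_ * _); apply: (sd_expn_mod sd).
have -> : ((2 * n - 1) * (2 * n) = (n - 1) * (4 * n) + 2 * n)%N by nia.
by rewrite modnMDl.
Qed.

(** The powers 1 and [a ^+ (2 * n)] are central and [<[a]>] is normal. Outside [<[a]>], conjugation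
    adds a multiple of [sd_step n] to the exponent, which preserves its parity and its divisibility
    by [sd_step n]. *)
Lemma sd_cellJ (n : nat) (gT : finGroupType) (G : {group gT}) (a b x g : gT) :
  sd_gens n G a b -> (1 < n)%N -> x \in G -> g \in G ->
  sd_cell n a b (x ^ g) = sd_cell n a b x.
Proof.
move=> sd n_gt1 xG gG.
have xgG : x ^ g \in G by rewrite groupJ.
have [[i xE]|[i xE]] := sd_memP sd xG.
  have xA : x ^ g \in <[a]>.
    have [[j gE]|[j gE]] := sd_memP sd xgG; first by rewrite gE mem_cycle.
    have : x \in (x ^ g) ^: G by rewrite class_sym memJ_class.
    rewrite gE (sd_class _ sd) // => /rcosetP[_ /cycleP[k ->] xE'].
    by have := sd_XbNA (sd_step n * k + j) sd; rewrite expgD -mulgA expgM -xE' xE mem_cycle.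
  rewrite /sd_cell xA xE mem_cycle -xE -(conj1g g) (inj_eq (conjg_inj g)).
  by rewrite -{1}(sd_centralX sd n_gt1 gG) (inj_eq (conjg_inj g)) conj1g.
have : x ^ g \in x ^: G by rewrite memJ_class.
rewrite xE (sd_class _ sd) // => /rcosetP[_ /cycleP[k ->] ->].
rewrite -expgM mulgA -expgD !(sd_cell_Xb _ sd) // /sd_step.
by case: (odd n); rewrite oddD oddM dvdn_addr ?dvdn_mulr.
Qed.

(** * Adjacency in terms of cells *)

(** A rotation [z] only generates rotations. If [z = a ^+ i * b], then its square is
    [a ^+ (2 * n * i)]: for odd [i] the powers of [z] meet cells 0, 1, 3, and for even [i] only cell
    0 and the cell of [z]. *)
Lemma sd_joined_cyclic (n : nat) (gT : finGroupType) (G : {group gT}) (a b x y z : gT) :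
  sd_gens n G a b -> (1 < n)%N -> z \in G -> x \in <[z]> -> y \in <[z]> ->
  sd_joined (sd_cell n a b x) (sd_cell n a b y).
Proof.
move=> sd n_gt1 zG xz yz.
have sub u : u \in <[z]> -> u \in G by apply/subsetP; rewrite cycle_subG.
have [[i zE]|[i zE]] := sd_memP sd zG.
  have zA : <[z]> \subset <[a]> by rewrite cycle_subG zE mem_cycle.
  rewrite /sd_joined !(sd_cell_cycle sd) ?sub //.
  by rewrite !(subsetP zA) ?orbT.
have bb : b * b = 1 by rewrite -expg2 (sd_sqb sd).
have z2 : z * z = a ^+ (2 * n * i).
  rewrite zE -mulgA [b * _]mulgA (sd_mulbX _ sd) -mulgA bb mulg1 -expgD.
  by congr (_ ^+ _); nia.
have c1 : sd_cell n a b 1 = 0%N by apply/eqP; rewrite sd_cell0.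
have cz : sd_cell n a b (a ^+ (2 * n)) = 1%N by apply/eqP; rewrite (sd_cell1 _ sd).
(* Even powers of [z] are powers of the central [a ^+ (2 * n * i)]; odd powers are these times [z]
   and stay in the cell of [z]. *)
have cellz u : u \in <[z]> ->
    sd_cell n a b u \in [:: 0; sd_cell n a b z; if odd i then 1 else 0]%N.
  case/cycleP=> j ->; rewrite -(odd_double_half j) addnC expgD -mul2n expgM expg2 z2 -expgM.
  case: (odd j); last first.
    rewrite mulg1; have [io|ie] := ifP.
      have -> : a ^+ (2 * n * i * j./2) = if odd j./2 then a ^+ (2 * n) else a ^+ 0.
        case: ifP => jo; apply: (sd_expn_mod sd).
          have -> : (2 * n * i * j./2 = (i * j./2)./2 * (4 * n) + 2 * n)%N.
            have : odd (i * j./2) by rewrite oddM io.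
            nia.
          by rewrite modnMDl.
        have -> : (2 * n * i * j./2 = (i * j./2./2) * (4 * n) + 0)%N.
          have h2 : j./2 = (j./2./2 * 2)%N by lia.
          by rewrite {1}h2; ring.
        by rewrite modnMDl.
      by case: ifP => _; rewrite ?expg0 ?c1 ?cz !inE ?eqxx ?orbT.
    have -> : a ^+ (2 * n * i * j./2) = a ^+ 0.
      apply: (sd_expn_mod sd).
      have -> : (2 * n * i * j./2 = (i./2 * j./2) * (4 * n) + 0)%N.
        have i2 : i = (i./2 * 2)%N by lia.
        by rewrite {1}i2; ring.
      by rewrite modnMDl.
    by rewrite expg0 c1.
  rewrite expg1 zE mulgA -expgD !(sd_cell_Xb _ sd) // oddD !oddM /=.
  case: ifP => io; rewrite ?inE ?eqxx ?orbT //.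
  rewrite dvdn_addr ?inE ?eqxx ?orbT //.
  apply: (dvdn_trans (sd_step_dvd n)); apply/dvdnP; exists (i./2 * j./2)%N.
  have i2 : i = (i./2 * 2)%N by lia.
  by rewrite {1}i2; ring.
have := cellz _ xz; have := cellz _ yz; rewrite zE (sd_cell_Xb _ sd) //.
move: (sd_cell _ _ _ x) (sd_cell _ _ _ y) => k l.
by case: ifP => _; rewrite !inE => /or3P[]/eqP-> /or3P[]/eqP->;
   rewrite /sd_joined ?eqxx ?orbT.
Qed.

(** The square of [a * b] is the central involution and its cube is [a ^+ (2 * n + 1) * b]. For even
    [n] cell 3 is a single class; for odd [n] it is two classes, with exponents 1 and 3 modulo 4,
    represented by [a * b] and its cube. *)
Lemma sd_conj_cycle_ab (n : nat) (gT : finGroupType) (G : {group gT}) (a b x : gT) :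
  sd_gens n G a b -> (1 < n)%N -> x \in G ->
  sd_cell n a b x \in [:: 1; 3]%N -> exists2 g, g \in G & x ^ g \in <[a * b]>.
Proof.
move=> sd n_gt1 xG; have bb : b * b = 1 by rewrite -expg2 (sd_sqb sd).
have ab2 : (a * b) ^+ 2 = a ^+ (2 * n).
  rewrite expg2 -mulgA [b * _]mulgA (sd_mulba sd) -mulgA bb mulg1 -expgS.
  by congr (_ ^+ _); lia.
rewrite !inE (sd_cell1 _ sd) // => /orP[/eqP->|].
  by exists 1; rewrite ?group1 // conjg1 -ab2 mem_cycle.
have [[i xE]|[i xE]] := sd_memP sd xG.
  have : x \in <[a]> by rewrite xE mem_cycle.
  by rewrite -(sd_cell_cycle sd n_gt1 xG); case: (sd_cell _ _ _ _) => [|[|[|]]].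
rewrite xE (sd_cell_Xb _ sd) //; case: ifP => io; last by case: ifP.
move=> _.
have cyc j : j \in [:: 1; 2 * n + 1]%N -> a ^+ j * b \in <[a * b]>.
  rewrite !inE => /orP[] /eqP->; first by rewrite expg1 cycle_id.
  by rewrite expgD -ab2 expg1 -mulgA -expgSr mem_cycle.
suff [j jP] : exists2 j, j \in [:: 1; 2 * n + 1]%N & (j == i %[mod sd_step n])%N.
  rewrite -(sd_mem_rcoset _ _ sd) ?sd_step_dvd // -(sd_class _ sd) //.
  by case/imsetP=> g gG xg; exists g => //; rewrite -xg cyc.
rewrite /sd_step; case: ifP => no; last by exists 1%N; rewrite ?inE // !modn2 io.
have : (i %% 4 = 1 \/ i %% 4 = 3)%N by lia.
by case=> ->; [exists 1%N | exists (2 * n + 1)%N]; rewrite ?inE ?eqxx ?orbT //; lia.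
Qed.

(** If the two conjugates coincide, they give no edge of the enhanced power graph, but then [x] and
    [y] are themselves conjugate. *)
Lemma cse_adj_conj_cycle (gT : finGroupType) (G : {group gT}) (x y z g h : gT) :
  x != y -> z \in G -> g \in G -> h \in G -> x ^ g \in <[z]> -> y ^ h \in <[z]> ->
  cse_adj G x y.
Proof.
move=> xy zG gG hG xz yz; rewrite /cse_adj xy /=.
have [e|ne] := eqVneq (x ^ g) (y ^ h).
  apply/orP; left; apply/imsetP; exists (h * g^-1); rewrite ?groupM ?groupV //.
  by rewrite conjgM -e conjgK.
apply/orP; right; apply/existsP; exists (x ^ g); rewrite memJ_class //=.
apply/existsP; exists (y ^ h); rewrite memJ_class //= /epg_adj ne /=.
by apply/existsP; exists z; rewrite zG xz.
Qed.

Lemma sd_adj (n : nat) (gT : finGroupType) (G : {group gT}) (a b : gT) :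
  sd_gens n G a b -> (1 < n)%N ->
  {in G &, forall x y, cse_adj G x y =
     (x != y) && sd_joined (sd_cell n a b x) (sd_cell n a b y)}.
Proof.
move=> sd n_gt1 x y xG yG; have cellJ := sd_cellJ sd n_gt1.
apply/idP/andP => [|[xy]].
  rewrite /cse_adj => /andP[-> /orP[/imsetP[g gG ->]|]].
    by rewrite cellJ // /sd_joined eqxx.
  case/existsP=> x' /andP[/imsetP[g gG ->] /existsP[y' /andP[/imsetP[h hG ->]]]].
  case/andP=> _ /existsP[z /and3P[zG xz yz]]; split=> //.
  rewrite -(cellJ x g) // -(cellJ y h) //.
  exact: sd_joined_cyclic sd n_gt1 zG xz yz.
have aG : a \in G by rewrite -(expg1 a) (sd_memX _ sd).
have abG : a * b \in G by rewrite -(expg1 a) (sd_memXb _ sd).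
have self u : u ^ 1 \in <[u]> by rewrite conjg1 cycle_id.
rewrite /sd_joined !sd_cell0 !(sd_cell_cycle sd) //.
have [y1|y1] := eqVneq y 1.
  move=> _; apply: (cse_adj_conj_cycle xy xG (group1 G) (group1 G)) => //.
  by rewrite y1 conj1g group1.
have [x1|x1] := eqVneq x 1.
  move=> _; apply: (cse_adj_conj_cycle xy yG (group1 G) (group1 G)) => //.
  by rewrite x1 conj1g group1.
rewrite !orFb => /or3P[/eqP e|/andP[xA yA]|/andP[x3 y3]]; last 2 first.
- by apply: (cse_adj_conj_cycle xy aG (group1 G) (group1 G)); rewrite conjg1.
- have [g gG xg] := sd_conj_cycle_ab sd n_gt1 xG x3.
  have [h hG yh] := sd_conj_cycle_ab sd n_gt1 yG y3.
  exact: (cse_adj_conj_cycle xy abG gG hG).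
(* Equal cells: rotations share [<[a]>] and cell 3 goes through [<[a * b]>], so what remains is
   cells 4 and 5, each within one conjugacy class. *)
case xA: (x \in <[a]>).
  have yA : y \in <[a]>.
    by rewrite -(sd_cell_cycle sd n_gt1 yG) -e (sd_cell_cycle sd n_gt1 xG).
  by apply: (cse_adj_conj_cycle xy aG (group1 G) (group1 G)); rewrite conjg1.
case x3: (sd_cell n a b x \in [:: 1; 3]%N).
  have [g gG xg] := sd_conj_cycle_ab sd n_gt1 xG x3.
  rewrite e in x3; have [h hG yh] := sd_conj_cycle_ab sd n_gt1 yG x3.
  exact: (cse_adj_conj_cycle xy abG gG hG).
have yA : y \in <[a]> = false.
  by rewrite -(sd_cell_cycle sd n_gt1 yG) -e (sd_cell_cycle sd n_gt1 xG).
have [[i xE]|[i xE]] := sd_memP sd xG; first by rewrite xE mem_cycle in xA.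
have [[j yE]|[j yE]] := sd_memP sd yG; first by rewrite yE mem_cycle in yA.
rewrite /cse_adj xy yE (sd_class _ sd) // xE (sd_mem_rcoset _ _ sd) ?sd_step_dvd //=.
apply/orP; left; move: e x3; rewrite xE yE !(sd_cell_Xb _ sd) // /sd_step.
by case: (odd n); rewrite ?dvdn2; case io: (odd i); case jo: (odd j) => //=;
   case i4: (4 %| i)%N; case j4: (4 %| j)%N => //=; lia.
Qed.

(** * Sizes of the cells *)

Lemma sd_card_rcoset (n : nat) (gT : finGroupType) (G : {group gT}) (a b : gT)
    (k m j : nat) :
  sd_gens n G a b -> (1 < n)%N -> (4 * n = m * k)%N ->
  #|<[a ^+ k]> :* (a ^+ j * b)| = m.
Proof.
move=> sd n_gt1 e; rewrite card_rcoset -orderE orderXdiv (sd_order sd) e ?dvdn_mull //.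
by rewrite mulnK //; lia.
Qed.

Lemma sd_card_cell (n : nat) (gT : finGroupType) (G : {group gT}) (a b : gT) (k : nat) :
  sd_gens n G a b -> (1 < n)%N ->
  #|[set x in G | sd_cell n a b x == k]| =
  nth 0 (if odd n then [:: 1; 1; 4 * n - 2; 2 * n; n; n]
         else [:: 1; 1; 4 * n - 2; 2 * n; 2 * n])%N k.
Proof.
move=> sd n_gt1; have oa := sd_order sd.
(* Each nonempty cell above 2 is a congruence class of exponents: 1 modulo 2 for cell 3, 0 modulo
   [sd_step n] for cell 4, and 2 modulo 4 for cell 5 with [n] odd. *)
have coset c j l : (l %| 4 * n)%N -> (2 < c)%N ->
   (forall i, (sd_cell n a b (a ^+ i * b) == c) = (i == j %[mod l])%N) ->
   #|[set x in G | sd_cell n a b x == c]| = #|<[a ^+ l]> :* (a ^+ j * b)|.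
  move=> l_n c_gt2 cE; congr #|pred_of_set _|; apply/setP=> x; rewrite inE.
  have xE i : x = a ^+ i * b -> (x \in G) && (sd_cell n a b x == c) =
       (x \in <[a ^+ l]> :* (a ^+ j * b)).
    by move=> ->; rewrite (sd_memXb _ sd) cE (sd_mem_rcoset _ _ sd).
  apply/idP/idP => [/[dup] xc /andP[xG /eqP cx]|/[dup] xH].
    have [[i xi]|[i xi]] := sd_memP sd xG; last by rewrite -(xE i).
    have : x \in <[a]> by rewrite xi mem_cycle.
    by rewrite -(sd_cell_cycle sd n_gt1 xG) cx leqNgt c_gt2.
  case/rcosetP=> _ /cycleP[t ->] xt; rewrite (xE (l * t + j)%N) //.
  by rewrite expgD expgM -mulgA.
case: k => [|[|[|k]]].
- rewrite [RHS](_ : _ = #|[set 1 : gT]|); last by rewrite cards1; case: (odd n).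
  congr #|pred_of_set _|; apply/setP=> x; rewrite !inE sd_cell0.
  by case: eqP => [->|]; rewrite ?group1 ?andbF.
- rewrite [RHS](_ : _ = #|[set a ^+ (2 * n)]|); last by rewrite cards1; case: (odd n).
  congr #|pred_of_set _|; apply/setP=> x; rewrite !inE (sd_cell1 _ sd) //.
  by case: eqP => [->|]; rewrite ?(sd_memX _ sd) ?andbF.
- have a2n1 : a ^+ (2 * n) != 1.
    have : sd_cell n a b (a ^+ (2 * n)) == 1%N by rewrite (sd_cell1 _ sd).
    by rewrite -(sd_cell0 n a b) => /eqP->.
  have -> : [set x in G | sd_cell n a b x == 2] = <[a]> :\ 1 :\ a ^+ (2 * n).
    apply/setP=> x; rewrite !inE; case xG: (x \in G); last first.
      rewrite andFb; apply/esym/negP => /and3P[_ _ /cycleP[i xi]].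
      by rewrite xi (sd_memX _ sd) in xG.
    rewrite -(sd_cell0 n a b) -(sd_cell1 x sd) // -(sd_cell_cycle sd n_gt1 xG).
    by case: (sd_cell n a b x) => [|[|[|]]].
  have := cardsD1 1 <[a]>; have := cardsD1 (a ^+ (2 * n)) (<[a]> :\ 1).
  rewrite !inE a2n1 mem_cycle group1 -orderE oa /=.
  by move=> e1; rewrite e1 => ->; case: (odd n) => /=; rewrite addnA addKn.
case: k => [|[|[|k]]].
- rewrite (coset _ 1 2)%N ?dvdn_mulr //.
    by rewrite (sd_card_rcoset _ sd n_gt1 (m := 2 * n)) ?if_same; [case: ifP | lia].
  by move=> i; rewrite (sd_cell_Xb _ sd) // !modn2; do 2?case: ifP => _.
- rewrite (coset _ 0 (sd_step n))%N ?sd_step_dvd //.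
    rewrite /sd_step; case: ifP => no.
      by rewrite (sd_card_rcoset _ sd n_gt1 (m := n)) // mulnC.
    by rewrite (sd_card_rcoset _ sd n_gt1 (m := 2 * n)) //; lia.
  move=> i; rewrite (sd_cell_Xb _ sd) // mod0n /sd_step.
  by case: (odd n); case: ifP => io; try (case: ifP => di); lia.
- case: ifP => no.
    rewrite (coset _ 2 4)%N ?dvdn_mulr //.
      by rewrite (sd_card_rcoset _ sd n_gt1 (m := n)) // mulnC.
    move=> i; rewrite (sd_cell_Xb _ sd) // /sd_step no.
    by case: ifP => io; try (case: ifP => di); lia.
  (* For even [n] the list has five entries, so [nth] returns its default 0, and indeed every even
     exponent lands in cell 4. *)
  apply/eqP; rewrite cards_eq0; apply/eqP/setP=> x; rewrite !inE.
  apply/negP => /andP[xG]; have [[i xi]|[i xi]] := sd_memP sd xG.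
    have : x \in <[a]> by rewrite xi mem_cycle.
    by rewrite -(sd_cell_cycle sd n_gt1 xG) => + /eqP cx; rewrite cx.
  by rewrite xi (sd_cell_Xb _ sd) // /sd_step no; case: ifP => // io; case: ifP => //; lia.
rewrite [RHS]nth_default; last by case: ifP.
apply/eqP; rewrite cards_eq0; apply/eqP/setP=> x; rewrite !inE /sd_cell.
by do 5?case: ifP => _; rewrite andbF.
Qed.

(** Keeps [inord] faithful below, with an index type that leaves out the empty cell 5 when [n] is
    even. *)
Lemma sd_cell_ub (n : nat) (gT : finGroupType) (G : {group gT}) (a b x : gT) :
  sd_gens n G a b -> (1 < n)%N -> x \in G ->
  (sd_cell n a b x < (if odd n then 6 else 5))%N.
Proof.
move=> sd n_gt1 xG; have [[i xi]|[i xi]] := sd_memP sd xG.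
  have : x \in <[a]> by rewrite xi mem_cycle.
  rewrite -(sd_cell_cycle sd n_gt1 xG) => /leq_ltn_trans; apply.
  by case: (odd n).
rewrite xi (sd_cell_Xb _ sd) // /sd_step.
by case: (odd n); rewrite ?dvdn2; case: (odd i) => //=; case: ifP.
Qed.

(* The Sombor characteristic polynomial for both parities *)
Local Close Scope group_scope.

Lemma sd_char_poly (R : rcfType) (n : nat) (gT : finGroupType) (G : {group gT})
    (a b : gT) (m : nat) (s d : seq nat) :
  sd_gens n G a b -> (1 < n)%N -> (if odd n then 6 else 5) = m.+1 ->
  (forall k, #|[set x in G | sd_cell n a b x == k]| = nth 0 s k)%N ->
  (forall k : 'I_m.+1, 0 < nth 0 s k)%N ->
  (forall k : 'I_m.+1,
     nth 0 d k = (\sum_(l < m.+1 | sd_joined k l) nth 0 s l).-1)%N ->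
  char_poly (sombor_mx R G (cse_adj G)) =
  \prod_(k < m.+1) ('X + ((nth 0 d k)%:R * Num.sqrt 2)%:P) ^+ (nth 0 s k).-1 *
  char_poly (\matrix_(k < m.+1, l < m.+1)
    if sd_joined k l
    then (nth 0 s l - (k == l))%:R * sb R (nth 0 d k) (nth 0 d l) else 0).
Proof.
move=> sd n_gt1 m_n cs s_gt0 ds.
have cell_val x : x \in G -> (inord (sd_cell n a b x) : 'I_m.+1) = sd_cell n a b x :> nat.
  by move=> xG; rewrite inordK // -m_n (sd_cell_ub sd).
apply: (@char_poly_sombor_cells _ _ _ _ _ (fun k l : 'I_m.+1 => sd_joined k l)
          (fun x => inord (sd_cell n a b x)) (fun k => nth 0%N s k) (fun k => nth 0%N d k)) => //.
- by move=> k; rewrite /= /sd_joined eqxx.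
- by move=> x y xG yG; rewrite (sd_adj sd) //= !cell_val.
move=> k; rewrite -cs; congr #|pred_of_set _|; apply/setP=> x; rewrite !inE.
by case xG: (x \in G) => //=; rewrite -val_eqE /= cell_val.
Qed.

Unset Implicit Arguments.

(* G is the semidihedral group SD_{8n} = <a,b | a^{4n} = b^2 = e, ba = a^{2n-1} b>
   (homomorphic image of the presented group, of order 8n, hence isomorphic).
   Sombor spectrum stated as: characteristic polynomial of the Sombor matrix
   equals prod (X - lambda)^mult times char_poly of the quotient matrix. *)
Theorem theorem5p8 (R : rcfType) (n : nat) (gT : finGroupType) (G : {group gT}) :
  (2 <= n)%N ->
  (G \homg Grp (a : b : (a ^+ (4 * n), b ^+ 2, b * a = a ^+ (2 * n - 1) * b)))%g ->
  #|G| = (8 * n)%N ->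
  char_poly (sombor_mx R G (cse_adj G)) =
  (if odd n then
     ('X + ((2 * n + 1)%:R * Num.sqrt 2)%:P) ^+ (2 * n - 1)
     * ('X + ((4 * n - 1)%:R * Num.sqrt 2)%:P) ^+ (4 * n - 3)
     * ('X + (n%:R * Num.sqrt 2)%:P) ^+ (2 * n - 2)
     * char_poly (Q_odd R n)
   else
     ('X + ((4 * n - 1)%:R * Num.sqrt 2)%:P) ^+ (4 * n - 3)
     * ('X + ((2 * n + 1)%:R * Num.sqrt 2)%:P) ^+ (2 * n - 1)
     * ('X + ((2 * n)%:R * Num.sqrt 2)%:P) ^+ (2 * n - 1)
     * char_poly (Q_even R n)).
Proof.
move=> n_gt1 homG cardG.
have [a [b sd]] := sd_gens_exist (ltnW n_gt1) homG cardG.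
have sbC x y : sb R x y = sb R y x by rewrite /sb addrC.
have cells k := sd_card_cell k sd n_gt1.
case: ifP => no; rewrite no in cells.
  (* The list [d] gives the degree on each cell, for instance [1 + 1 + (4 * n - 2) + 2 * n - 1 = 6 *
     n - 1] for the central involution. *)
  rewrite (sd_char_poly (m := 5) (d := [:: 8 * n - 1; 6 * n - 1; 4 * n - 1; 2 * n + 1; n; n]%N)
     R sd n_gt1 _ cells) ?no //; last 2 first.
  - by case; do 6?[case=> [|]] => //= _; lia.
  - case; do 6?[case=> [|]] => //= _; rewrite big_mkcond !big_ord_recl big_ord0 /=; lia.
  congr (_ * _); last congr char_poly.
    (* The two singleton cells contribute exponent 0; cells 4 and 5 have the same degree, so their
       exponents [n - 1] add up to [2 * n - 2]. *)
    rewrite !big_ord_recl big_ord0 /= !expr0 !mul1r mulr1 -exprD mulrCA mulrA.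
    by congr (_ ^+ _ * _ ^+ _ * _ ^+ _); lia.
  apply/matrixP=> -[i lti] [j ltj]; rewrite !mxE /= -val_eqE /=.
  (* Entries below the diagonal need the symmetry of [sb]; the nonzero diagonal ones are [s - 1]
     times [d] times the root of 2. *)
  case: i lti => [|[|[|[|[|[|//]]]]]] _; case: j ltj => [|[|[|[|[|[|//]]]]]] _ //=;
    rewrite ?subn0 ?subnn ?mul0r ?mul1r;
    first [by [] | by rewrite sbC |
      by rewrite sb_diag mulrA -natrM; congr (_%:R * _); nia].
rewrite (sd_char_poly (m := 4) (d := [:: 8 * n - 1; 6 * n - 1; 4 * n - 1; 2 * n + 1; 2 * n]%N)
   R sd n_gt1 _ cells) ?no //; last 2 first.
- by case; do 5?[case=> [|]] => //= _; lia.
- case; do 5?[case=> [|]] => //= _; rewrite big_mkcond !big_ord_recl big_ord0 /=; lia.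
congr (_ * _); last congr char_poly.
  rewrite !big_ord_recl big_ord0 /= !expr0 !mul1r mulr1 mulrA.
  by congr (_ ^+ _ * _ ^+ _ * _ ^+ _); lia.
apply/matrixP=> -[i lti] [j ltj]; rewrite !mxE /= -val_eqE /=.
case: i lti => [|[|[|[|[|//]]]]] _; case: j ltj => [|[|[|[|[|//]]]]] _ //=;
  rewrite ?subn0 ?subnn ?mul0r ?mul1r;
    first [by [] | by rewrite sbC |
      by rewrite sb_diag mulrA -natrM; congr (_%:R * _); nia].
Qed.
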